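(* Let $X\subseteq2^{\mathbb{Z}}$ be a minimal subshift of finite symbolic rank and let $Y\subseteq2^{\mathbb{Z}}$ be an infinite subshift that is a factor of $X$. Then $Y$ has finite symbolic rank, i.e., there is an infinite word $V$ with a finite rank construction (a rank-$n$ construction for some $n\ge1$) such that $Y=X_V$.
   Context: $2^{\mathbb{Z}}=\{0,1\}^{\mathbb{Z}}$ has the product topology, $\sigma(x)(n)=x(n+1)$. A subshift is a closed set $X\subseteq 2^{\mathbb{Z}}$ with $\sigma X=X$, identified with $(X,\sigma)$; it is minimal if every orbit is dense in $X$. $Y$ is a factor of $X$ if there is a continuous surjection $\varphi:X\to Y$ with $\varphi\sigma=\sigma\varphi$. For an infinite word $V\in\{0,1\}^{\mathbb{N}}$, $X_V=\{x\in 2^{\mathbb{Z}}:$ every finite subword of $x$ is a subword of $V\}$. Let $\mathcal{F}$ be the set of finite $0,1$-words that begin and end with $0$. For finite $S\subseteq\mathcal{F}$ and $w\in\mathcal{F}$, a building of $w$ from $S$ consists of $v_1,\dots,v_{k+1}\in S$ and nonnegative integers $s_1,\dots,s_k$, $k\ge 1$, with $w=v_1 1^{s_1}v_2\cdots v_k1^{s_k}v_{k+1}$; then $w$ is built from $S$ starting with $v_1$. For $n\ge1$, a rank-$n$ generating sequence is a family $\{v_{i,j}\}_{i\ge0,1\le j\le n_i}$ of finite words such that for all $i\ge 0$: $n_i\le n$; $v_{0,j}=0$ for all $1\le j\le n_0$; $v_{i+1,1}$ is built from $S_i=\{v_{i,1},\dots,v_{i,n_i}\}$ starting with $v_{i,1}$;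 and $v_{i+1,j}$ is built from $S_i$ for all $2\le j\le n_{i+1}$. A rank-$n$ construction is such a sequence together with one chosen building of each $v_{i+1,j}$ from $S_i$ (that of $v_{i+1,1}$ starting with $v_{i,1}$); it is a construction of the infinite word $V=\lim_i v_{i,1}$. A subshift $X$ has finite symbolic rank if, for some $n\ge1$, $X=X_V$ for some $V$ having a rank-$n$ construction. *)

(* Defs.v *)
From HB Require Import structures.
From mathcomp Require Import all_boot all_order all_algebra.
From mathcomp Require Import all_classical all_reals all_analysis.

Set Implicit Arguments.
Unset Strict Implicit.
Unset Printing Implicit Defensive.

Import Order.TTheory GRing.Theory Num.Theory.

Local Open Scope classical_set_scope.

(* The letters 0 and 1 are [false] and [true], and [bool] carries the discrete
   topology. *)
Definition word := seq bool.

Definition fullshift : Type := prod_topology (fun _ : int => bool).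
HB.instance Definition _ := Topological.on fullshift.

Definition shift_by (k : int) (x : fullshift) : fullshift :=
  fun n => x (n + k)%R.

Definition shift_map : fullshift -> fullshift := shift_by 1%R.

Definition shift_orbit (x : fullshift) : set fullshift :=
  range (fun k : int => shift_by k x).

Definition subshift (X : set fullshift) : Prop :=
  closed X /\ shift_map @` X = X.

Definition minimal_subshift (X : set fullshift) : Prop :=
  subshift X /\ forall x, X x -> X `<=` closure (shift_orbit x).

(* A map X -> Y is given by a total function on the full shift; only its values
   on X matter. *)
Definition is_factor (Y X : set fullshift) : Prop :=
  exists phi : fullshift -> fullshift,
    [/\ {within X, continuous phi}, phi @` X = Y &
        forall x, X x -> phi (shift_map x) = shift_map (phi x)].

Definition subword_bi (u : word) (x : fullshift) : Prop :=
  exists m : int, u = mkseq (fun i => x (m + i%:Z)%R) (size u).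

Definition subword_inf (u : word) (V : nat -> bool) : Prop :=
  exists m : nat, u = mkseq (fun i => V (m + i)) (size u).

Definition X_of (V : nat -> bool) : set fullshift :=
  [set x | forall u : word, subword_bi u x -> subword_inf u V].

Definition inF (w : word) : bool :=
  [&& w != [::], ~~ head true w & ~~ last true w].

(* [Building v_1 [:: (s_1, v_2); ...; (s_k, v_(k+1))]] encodes the expression
   v_1 1^(s_1) v_2 ... v_k 1^(s_k) v_(k+1). *)
Record building := Building {
  bfirst : word;
  brest : seq (nat * word)
}.

Definition bwords (b : building) : seq word :=
  bfirst b :: [seq p.2 | p <- brest b].

Definition bvalue (b : building) : word :=
  bfirst b ++ flatten [seq nseq p.1 true ++ p.2 | p <- brest b].

Definition building_of (S : seq word) (w : word) (b : building) : Prop :=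
  [/\ all inF S, inF w, brest b != [::], {subset bwords b <= S} & bvalue b = w].

Definition built_from (S : seq word) (w : word) : Prop :=
  exists b, building_of S w b.

Definition built_from_starting (S : seq word) (v w : word) : Prop :=
  exists2 b, building_of S w b & bfirst b = v.

(* The family v_(i,j), 1 <= j <= r i, is given by a total function; its values
   at other indices are irrelevant. *)
Definition level (r : nat -> nat) (v : nat -> nat -> word) (i : nat) : seq word :=
  [seq v i j | j <- iota 1 (r i)].

Definition generating_sequence (n : nat) (r : nat -> nat)
    (v : nat -> nat -> word) : Prop :=
  [/\ forall i, 1 <= r i <= n,
      forall j, 1 <= j <= r 0 -> v 0 j = [:: false],
      forall i, built_from_starting (level r v i) (v i 1) (v i.+1 1) &
      forall i j, 2 <= j <= r i.+1 -> built_from (level r v i) (v i.+1 j)].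

(* [rc_bld i j] is the chosen building of v_(i+1,j) from S_i. *)
Record rank_construction (n : nat) := RankConstruction {
  rc_size : nat -> nat;
  rc_word : nat -> nat -> word;
  rc_bld : nat -> nat -> building;
  rc_gen : generating_sequence n rc_size rc_word;
  rc_bldP : forall i j, 1 <= j <= rc_size i.+1 ->
    building_of (level rc_size rc_word i) (rc_word i.+1 j) (rc_bld i j);
  rc_bld1 : forall i, bfirst (rc_bld i 1) = rc_word i 1
}.

Definition word_limit (w : nat -> word) (V : nat -> bool) : Prop :=
  forall m : nat, \forall i \near \oo,
    m < size (w i) /\ nth false (w i) m = V m.

Definition construction_of (n : nat) (c : rank_construction n)
    (V : nat -> bool) : Prop :=
  word_limit (fun i => rc_word c i 1) V.

Definition finite_symbolic_rank (X : set fullshift) : Prop :=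
  exists n : nat, 1 <= n /\
    exists V : nat -> bool,
      (exists c : rank_construction n, construction_of c V) /\ X = X_of V.

(* Main.v *)
(* By compactness the factor map is a sliding block code, so if X = X_V then,
   up to a shift, Y = X_W where W is the image of V under a code looking only
   to the right.  Fix a construction of V with level sets S_i.  The pieces of W
   lying over the occurrences in V of v 1^s, with v in S_i, are determined by
   v, s and the bounded context to the right, and s is bounded because 1^oo is
   not in X: hence there are boundedly many pieces at each level, and a piece
   of level i+1 is a concatenation of at least two pieces of level i.
   Recognizability plays no role.  As 1^oo is not in Y either, long pieces
   contain zeros; stripping the 1s at both ends of each piece turns these
   concatenations into buildings, and yields a construction of the tail of W
   starting at its first zero. *)
Require Import Defs.
From mathcomp Require Import all_boot all_order all_algebra.
From mathcomp Require Import all_classical all_reals all_analysis.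
From mathcomp Require Import zify.

Set Implicit Arguments.
Unset Strict Implicit.
Unset Printing Implicit Defensive.

Local Open Scope classical_set_scope.

(** * Words stripped of their outer 1s *)

Definition segment (V : nat -> bool) (p l : nat) : word :=
  mkseq (fun i => V (p + i)) l.

Lemma size_segment V p l : size (segment V p l) = l.
Proof. by rewrite size_mkseq. Qed.

Lemma segmentD V p l m :
  segment V p (l + m) = segment V p l ++ segment V (p + l) m.
Proof.
rewrite /segment /mkseq iotaD map_cat add0n; congr (_ ++ _).
rewrite -[l in iota l m]addn0 iotaDl -map_comp.
by apply: eq_map => i /=; rewrite addnA.
Qed.

Lemma segment_cat V p u v :
  segment V p (size (u ++ v)) = u ++ v ->
  segment V p (size u) = u /\ segment V (p + size u) (size v) = v.
Proof.
rewrite size_cat segmentD => /eqP; rewrite eqseq_cat ?size_segment //.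
by case/andP => /eqP-> /eqP->.
Qed.

Definition core (u : word) : word :=
  let t := drop (index false u) u in take (size t - index false (rev t)) t.

Lemma index_nseq_true p (v : word) :
  index false (nseq p true ++ v) = p + index false v.
Proof. by elim: p => //= p ->. Qed.

Lemma inFP (v : word) : inF v -> exists a, v = false :: a.
Proof. by case: v => [|[] a] //; exists a. Qed.

Lemma inF_cat (v s w : word) : inF v -> inF w -> inF (v ++ s ++ w).
Proof.
move=> /inFP [a ->] /[dup] /inFP [b ->].
by rewrite /inF /= !last_cat.
Qed.

Lemma inF_rev (v : word) : inF (rev v) = inF v.
Proof.
case: (lastP v) => // s x; case: s => [|y s].
  by rewrite /inF /=.
rewrite rev_rcons /inF /= rev_cons !last_rcons.
by case: x; case: y.
Qed.

Lemma core_pad p q (v : word) :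
  inF v -> core (nseq p true ++ v ++ nseq q true) = v.
Proof.
move=> Fv; rewrite /core index_nseq_true.
have [a va] := inFP Fv.
have -> : index false (v ++ nseq q true) = 0 by rewrite va.
rewrite addn0 drop_size_cat ?size_nseq // rev_cat.
have -> : rev (nseq q true) = nseq q true.
  by apply: (@eq_from_nth _ false); rewrite size_rev ?size_nseq // => i iq;
     rewrite nth_rev ?size_nseq // !nth_nseq iq; case: ifP => //; lia.
rewrite index_nseq_true.
have [b vb] : exists b, rev v = false :: b by apply: inFP; rewrite inF_rev.
by rewrite vb /= addn0 size_cat size_nseq addnK take_size_cat.
Qed.

Lemma take_index_false (u : word) :
  take (index false u) u = nseq (index false u) true.
Proof. by elim: u => //= [[] u] //= ->. Qed.

Lemma coreP (u : word) : false \in u ->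
  exists p q, u = nseq p true ++ core u ++ nseq q true /\ inF (core u).
Proof.
move=> u0.
have e1 := cat_take_drop (index false u) u; rewrite take_index_false in e1.
set t := drop (index false u) u in e1.
have [t' et] : exists t', t = false :: t'.
  exists (behead t); rewrite /t (drop_nth false) ?index_mem //=.
  by rewrite nth_index.
have e2 := cat_take_drop (index false (rev t)) (rev t).
rewrite take_index_false in e2.
set w := drop (index false (rev t)) (rev t) in e2.
have rt0 : false \in rev t by rewrite mem_rev et mem_head.
have [w' ew] : exists w', w = false :: w'.
  exists (behead w); rewrite /w (drop_nth false) ?index_mem //=.
  by rewrite nth_index.
have [q eq] : exists q, t = rev w ++ nseq q true.
  exists (index false (rev t)); rewrite -[t]revK -{1}e2 rev_cat revK.
  congr (_ ++ _); apply: (@eq_from_nth _ false); rewrite size_rev ?size_nseq //.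
  by move=> i iq; rewrite nth_rev ?size_nseq // !nth_nseq iq; case: ifP => //; lia.
have Fw : inF (rev w).
  rewrite eq in et; move: et; rewrite ew rev_cons; case: (rev w') => [|x s] //=.
  by case=> -> _; rewrite /inF /= last_rcons.
have ec : core u = rev w by rewrite -e1 eq core_pad.
by exists (index false u), q; rewrite ec Fw -eq e1.
Qed.

(* Padding by 1s around and between the words is absorbed into the spacers. *)
Lemma core_flatten (us : seq word) :
  us != [::] -> {in us, forall u, false \in u} ->
  exists b, [/\ bwords b = map core us, inF (bvalue b) &
                core (flatten us) = bvalue b].
Proof.
move=> us0 H.
suff [p [q [b [bw Fb e]]]] : exists p q b, [/\ bwords b = map core us,
    inF (bvalue b) & flatten us = nseq p true ++ bvalue b ++ nseq q true].
  by exists b; split => //; rewrite e core_pad.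
elim: us us0 H => // u [|w us] IH _ H.
  have /coreP [p [q [e Fc]]] : false \in u by apply: H; rewrite mem_head.
  exists p, q, (Building (core u) [::]); split => //=.
    by rewrite /bvalue /= cats0.
  by rewrite /bvalue /= !cats0.
have /coreP [p [q [e Fc]]] : false \in u by apply: H; rewrite mem_head.
have [||p' [q' [b [bw Fb e']]]] := IH; first by [].
  by move=> x xI; apply: H; rewrite inE xI orbT.
exists p, q', (Building (core u) ((q + p', bfirst b) :: brest b)); split.
- by move: bw; rewrite /bwords /= => ->.
- by rewrite /bvalue /= -catA; apply: inF_cat.
- rewrite -cat1s flatten_cat e' /= cats0 {1}e /bvalue /= nseqD.
  by rewrite -!catA.
Qed.

(** Each 1 goes with the next 0, and trailing 1s go with the last 0. This supplies the bottom level,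
    where every core must be the word 0; the count of zeros later guarantees at least two
    factors. *)
Lemma split_zeros (u : word) : false \in u ->
  exists us, [/\ size us = count_mem false u,
    {in us, forall w, false \in w /\ core w = [:: false]} & flatten us = u].
Proof.
elim: u => // [[]] u IH; rewrite inE /=.
  move=> u0; have [[|w us] [su H e]] := IH u0; first by rewrite -e in u0.
  exists ((true :: w) :: us); split => //=; last by rewrite -e.
  move=> x; rewrite inE => /orP [/eqP-> |xI]; last by apply: H; rewrite inE xI orbT.
  have [w0 cw] := H w (mem_head _ _); split; first by rewrite inE.
  have [p [q [ew Fw]]] := coreP w0.
  by rewrite ew -cat_cons (core_pad p.+1 q Fw).
move=> _; case: (boolP (false \in u)) => [/IH [us [su H e]]|u0].
  exists ([:: false] :: us); split => //=; first by rewrite su.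
    by move=> x; rewrite inE => /orP [/eqP-> |/H].
  by rewrite e.
exists [:: false :: u]; split => //=; last by rewrite cats0.
  by rewrite (count_memPn u0).
move=> x; rewrite inE => /eqP->; split; first exact: mem_head.
have -> : u = nseq (size u) true.
  by apply/all_pred1P/allP => -[] // /(negP u0).
exact: (core_pad 0 (size u) (v := [:: false])).
Qed.

(** * Constructions from nested concatenations *)

Lemma subword_bi_pad (x : fullshift) (u : word) k :
  subword_bi u x -> exists a, size a = k /\ subword_bi (a ++ u) x.
Proof.
case=> m ->; set l := size u.
exists (mkseq (fun i => x (m - k%:Z + i%:Z)%R) k); split; first by rewrite size_mkseq.
exists (m - k%:Z)%R; rewrite size_cat !size_mkseq.
rewrite [RHS]/mkseq iotaD map_cat add0n; congr (_ ++ _).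
rewrite -[k in iota k l]addn0 iotaDl -map_comp.
by apply: eq_map => i /=; congr (x _); lia.
Qed.

(** A subword of a bi-infinite sequence extends to the left by [p] letters, and an occurrence of the
    extended word in [W] puts the subword itself at a position at least [p]. *)
Lemma X_of_tail (W : nat -> bool) p :
  X_of (fun m => W (p + m)) = X_of W.
Proof.
apply/seteqP; split => x /= H u /[dup] ux.
  by move=> /H [m e]; exists (p + m); rewrite e size_mkseq; apply: eq_map => i; rewrite addnA.
move=> /(@subword_bi_pad _ _ p) [a [sa /H [m]]].
rewrite -/(segment W m (size (a ++ u))) => /esym /segment_cat [_ e].
exists m; rewrite -{1}e; apply: eq_map => i; congr (W _); lia.
Qed.

(** [P i] describes the pieces of level [i]; only their cores enter the construction, so only the
    cores are bounded in number. The prefixes [segment W 0 (d i)] yield the words v_(i,1), and the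
    last clause makes the building of v_(i+1,1) start with v_(i,1). *)
Lemma finite_rank_of_concatenations (W : nat -> bool) (P : nat -> word -> Prop)
    (N : nat) (d : nat -> nat) :
  (forall i, exists l : seq word,
     size l <= N /\ forall u, P i u -> core u \in l) ->
  (forall u, P 0 u -> core u = [:: false]) ->
  (forall i u, P i u -> false \in u) ->
  (forall i, P i (segment W 0 (d i))) ->
  (forall i u, P i.+1 u -> exists us, [/\ 1 < size us,
     forall w, w \in us -> P i w, flatten us = u &
     u = segment W 0 (d i.+1) ->
       core (head [::] us) = core (segment W 0 (d i))]) ->
  finite_symbolic_rank (X_of W).
Proof.
move=> Pfin P0 Pz Pd Pstep.
have [l /all_and2 [lN lP]] := choice Pfin.
pose c i := core (segment W 0 (d i)).
pose isc i (w : word) := exists2 u, P i u & w = core u.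
(* Index 1 is reserved for the core of the distinguished prefix. After filtering, every listed word
   is the core of a piece and so can be decomposed; repetitions are harmless. *)
pose lst i := c i :: [seq w <- l i | `[< isc i w >]].
have lstP i w : w \in lst i -> isc i w.
  rewrite inE mem_filter => /orP [/eqP-> |/andP [/asboolP //]].
  by exists (segment W 0 (d i)).
have Plst i u : P i u -> core u \in lst i.
  move=> Pu; rewrite inE mem_filter lP //.
  have -> : `[< isc i (core u) >] by apply/asboolP; exists u.
  by rewrite orbT.
pose r i := size (lst i).
pose v i j := nth [::] (lst i) j.-1.
have levelE i : level r v i = lst i.
  rewrite /level -[1]addn0 iotaDl -map_comp.
  by rewrite -[RHS](mkseq_nth [::]); apply: eq_map => j.
have vin i j : 0 < j <= r i -> v i j \in lst i.
  by move=> jr; rewrite /v mem_nth //; case: j jr.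
have lstF i : all inF (lst i).
  apply/allP => w /lstP [u Pu ->].
  by have [p [q []]] := coreP (Pz _ _ Pu).
have bldE ij : exists b, 1 <= ij.2 <= r ij.1.+1 ->
    building_of (level r v ij.1) (v ij.1.+1 ij.2) b /\
    (ij.2 = 1 -> bfirst b = v ij.1 1).
  case: ij => i j /=.
  case: (boolP (1 <= j <= r i.+1)) => [jr|_]; last by exists (Building [::] [::]).
  (* A core does not determine its piece. For [j = 1] the prefix itself is chosen, because the first
     factor is controlled only there. *)
  have [u Pu [eu ju]] : exists2 u, P i.+1 u &
      v i.+1 j = core u /\ (j = 1 -> u = segment W 0 (d i.+1)).
    case: (eqVneq j 1) => [->|j1].
      by exists (segment W 0 (d i.+1)).
    have [u Pu eu] := lstP _ _ (vin _ _ jr).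
    by exists u => //; split => // je; rewrite je eqxx in j1.
  have [us [us1 usP eus ush]] := Pstep _ _ Pu.
  have [||b [bw Fb be]] := @core_flatten us; first by case: us us1 {usP eus ush}.
    by move=> w /usP /Pz.
  exists b => _; split.
    rewrite levelE; split => //.
    - by rewrite eu -eus be.
    - have : size (bwords b) = size us by rewrite bw size_map.
      by rewrite /bwords /=; case: (brest b) => //= e; rewrite -e in us1.
    - by rewrite bw => w /mapP [x /usP /Plst xI ->].
    - by rewrite eu -eus.
  move=> /ju /ush {ush}; case: us us1 bw {usP eus be} => //= w us _.
  by rewrite /bwords; case=> -> _ ->.
have [bld bldP] := choice bldE.
have r1 i : 0 < r i by [].
have gen : generating_sequence N.+1 r v.
  split.
  - move=> i; rewrite r1 /= /r /= ltnS; apply: leq_trans (lN i).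
    by rewrite size_filter count_size.
  - by move=> j /vin /lstP [u /P0 e ->].
  - move=> i; have [] := bldP (i, 1); first by rewrite /= r1.
    by move=> /= H1 H2; exists (bld (i, 1)) => //; exact: H2.
  - move=> i j j2; have [] := bldP (i, j); first by move: j2 => /=; lia.
    by move=> /= H1 _; exists (bld (i, j)).
have bP i j : 1 <= j <= r i.+1 ->
    building_of (level r v i) (v i.+1 j) (bld (i, j)).
  by move=> jr; have [] := bldP (i, j).
have b1 i : bfirst (bld (i, 1)) = v i 1 by have [_] := bldP (i, 1) (r1 _); exact.
pose rc := @RankConstruction N.+1 r v (fun i j => bld (i, j)) gen bP b1.
have [p [Wp Wlt]] : exists p, W p = false /\ forall q, q < p -> W q.
  have exW : exists p, ~~ W p.
    have /mapP[q _ e] := Pz _ _ (Pd 0); exists q.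
    by rewrite -e.
  exists (ex_minn exW); case: ex_minnP => p Wp pmin; split; first exact/negbTE.
  by move=> q qp; apply/negPn/negP => /pmin; lia.
exists N.+1; split => //; exists (fun m => W (p + m)).
rewrite X_of_tail; split => //; exists rc.
rewrite /construction_of /= => m.
(* A building has at least two nonempty words, so lengths increase strictly and position [m] exists
   from level [m] on. *)
have sz i : i < size (v i 1).
  elim: i => [|i IH].
    by rewrite /v /= /c P0.
  case: (bP i 1); first by rewrite r1.
  move=> _ _ b0 bs <-; rewrite /bvalue size_cat b1.
  case E: (brest _) b0 bs => [//|[s w] rest] _ /= bs.
  have : w \in lst i by rewrite -levelE; apply: bs; rewrite /bwords E /= !inE eqxx orbT.
  move=> /(allP (lstF i)) /inFP [a ->].
  rewrite !size_cat /=; lia.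
exists m => // i /= mi; split; first by have := sz i; lia.
have mlt : m < size (v i 1) by have := sz i; lia.
move: mlt; rewrite /v /= /c /core.
set u := segment _ _ _.
have ie : index false u = p.
  have lt : index false u < d i.
    by rewrite -(size_segment W 0 (d i)) index_mem; apply: Pz (Pd i).
  have Wi : W (index false u) = false.
    by have := nth_index false (Pz _ _ (Pd i)); rewrite nth_mkseq.
  case: (ltngtP (index false u) p) => // [/Wlt|pi]; first by rewrite Wi.
  have /= := before_find false pi.
  by rewrite nth_mkseq ?add0n ?Wp //; apply: ltn_trans lt.
rewrite size_take_min ie leq_min => /andP [m1 m2]; rewrite nth_take // nth_drop.
rewrite size_drop size_segment in m2.
by rewrite nth_mkseq ?add0n //; lia.
Qed.

(** * Pieces of a coded word *)

(** Each spacer is attached to the word before it, so the pieces over the successive words of a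
    building follow each other without gaps. The run of length [s] need not be maximal in [V]. *)
Definition block_over (V W : nat -> bool) (S : seq word) (u : word) : Prop :=
  exists p v s, [/\ v \in S, segment V p (size v + s) = v ++ nseq s true &
                    u = segment W p (size v + s)].

(** Induction along the building; the final run [s] goes to its last word. The formula for the head
    serves to recognize, over v_(i+1,1) at position 0, the distinguished prefix of the level
    below. *)
Lemma block_over_building V W S b p s :
  {subset bwords b <= S} ->
  segment V p (size (bvalue b) + s) = bvalue b ++ nseq s true ->
  exists us, [/\ size us = size (bwords b),
    forall u, u \in us -> block_over V W S u,
    flatten us = segment W p (size (bvalue b) + s) &
    brest b != [::] -> head [::] us =
      segment W p (size (bfirst b) + (head (0, [::]) (brest b)).1)].
Proof.
case: b => f rest; elim: rest f p => [|[t w] rest IH] f p bS e.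
  exists [:: segment W p (size f + s)].
  rewrite /bvalue /= !cats0 in e *; split => // u; rewrite inE => /eqP->.
  by exists p, f, s; split => //; apply: bS; rewrite mem_head.
have vE : bvalue (Building f ((t, w) :: rest)) =
    (f ++ nseq t true) ++ bvalue (Building w rest).
  by rewrite /bvalue /= -!catA.
set X := f ++ nseq t true in vE; set Y := bvalue (Building w rest) in vE.
have : segment V p (size (X ++ (Y ++ nseq s true))) = X ++ (Y ++ nseq s true).
  by move: e; rewrite vE catA [size (_ ++ nseq s true)]size_cat size_nseq.
move=> /segment_cat []; rewrite [size (Y ++ _)]size_cat size_nseq => e1 e2.
have [|us [us1 us2 us3 _]] := IH _ _ _ e2.
  by move=> x xI; apply: bS; rewrite inE; apply/orP; right.
have sX : size X = size f + t by rewrite size_cat size_nseq.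
rewrite sX in e1.
exists (segment W p (size f + t) :: us); split => //=.
- by rewrite us1.
- move=> u; rewrite inE => /orP [/eqP->|/us2 //].
  by exists p, f, t; split => //; apply: bS; rewrite mem_head.
- by rewrite us3 vE size_cat sX -segmentD addnA.
Qed.

(** The bound counts the choices of [v], of a run length below [B], and of the [R] letters of [V]
    after the block, which suffice to apply [g] up to the last letter of the piece. *)
Lemma finite_blocks_over V (g : word -> bool) R B (S : seq word) :
  let W m := g (segment V m R) in
  (forall p, exists2 i, i < B & V (p + i) = false) ->
  exists l : seq word, size l <= size S * B * 2 ^ R /\
    forall u, block_over V W S u -> u \in l.
Proof.
move=> W runs.
pose F v (a : word) l := mkseq (fun i => g (take R (drop i (v ++ a)))) l.
pose ctx := [seq val t | t <- enum {: R.-tuple bool}].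
pose l1 := [seq v ++ nseq s true | v <- S, s <- iota 0 B].
exists [seq F v a (size v) | v <- l1, a <- ctx]; split.
  by rewrite !size_allpairs size_iota size_map -cardE card_tuple card_bool.
move=> u [p [v [s [vS e ->]]]].
have sB : s < B.
  rewrite ltnNge; apply/negP => Bs; have [i iB] := runs (p + size v).
  move: e; rewrite -[s in segment _ _ (_ + s)](size_nseq s true) -size_cat.
  move=> /segment_cat [_]; rewrite size_nseq => /(congr1 (nth false ^~ i)).
  rewrite nth_mkseq ?nth_nseq; last by lia.
  by rewrite (leq_trans iB Bs) => ->.
apply/allpairsP; exists (v ++ nseq s true, segment V (p + (size v + s)) R) => /=.
split.
- by apply/allpairsP; exists (v, s); rewrite /= mem_iota.
- apply/mapP.
  have h : size (segment V (p + (size v + s)) R) == R by rewrite size_segment.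
  by exists (Tuple h); rewrite ?mem_enum.
- rewrite size_cat size_nseq /F -e -segmentD.
  apply/eq_in_map => i; rewrite mem_iota add0n => il.
  rewrite /W; congr g.
  rewrite -(subnKC (ltnW il)) -addnA segmentD drop_size_cat ?size_segment //.
  by rewrite [_ - i + R]addnC segmentD take_size_cat ?size_segment.
Qed.

(** * Level words and prefixes of a construction *)

Section Levels.
Variables (n : nat) (c : rank_construction n).

Let S i := level (rc_size c) (rc_word c) i.

Lemma level_memP i v : v \in S i ->
  exists2 j, 1 <= j <= rc_size c i & v = rc_word c i j.
Proof.
case/mapP => j; rewrite mem_iota add1n => jr ->; exists j => //.
Qed.

Lemma rc_size_gt0 i : 1 <= rc_size c i.
Proof. by case: (rc_gen c) => H _ _ _; have := H i; lia. Qed.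

Lemma level_inF i : all inF (S i).
Proof. by have [] := rc_bldP (r := c) (i := i) (j := 1) (rc_size_gt0 _). Qed.

Lemma level_size i v : v \in S i -> i < size v.
Proof.
elim: i v => [|i IH] v vS.
  by have /inFP [a ->] := allP (level_inF 0) _ vS.
have [j jr ->] := level_memP vS.
have [_ _] := rc_bldP jr; case: (rc_bld c i j) => f [//|[s w] rest] _ bS <-.
have fS := IH f (bS f (mem_head _ _)).
have /inFP [a wa] : inF w.
  by apply: (allP (level_inF i)); apply: bS; rewrite /bwords /= !inE eqxx orbT.
by rewrite /bvalue size_cat -addn1 leq_add //= wa !size_cat /= addnS.
Qed.

(** With this many 1s appended, v_(i,1) still begins v_(i+1,1), hence [V]: this is the block under
    the distinguished prefix of [W]. The default is never reached, since a chosen building has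
    nonempty [brest]. *)
Definition first_spacer i := (head (0, [::]) (brest (rc_bld c i 1))).1.

Lemma rc_word1S i : exists t,
  rc_word c i.+1 1 = rc_word c i 1 ++ nseq (first_spacer i) true ++ t.
Proof.
have [_ _ b0 _ <-] := rc_bldP (r := c) (i := i) (j := 1) (rc_size_gt0 _).
rewrite /first_spacer -rc_bld1; case: (rc_bld c i 1) b0 => f [//|[s w] rest] _.
by exists (w ++ flatten [seq nseq q.1 true ++ q.2 | q <- rest]); rewrite /bvalue /= -!catA.
Qed.

(** Each v_(i,1) begins v_(i+1,1), so its letters persist to a level at which the letter in question
    already agrees with [V]. *)
Lemma construction_prefix V i : construction_of c V ->
  segment V 0 (size (rc_word c i 1)) = rc_word c i 1.
Proof.
move=> cV; apply: (@eq_from_nth _ false); first by rewrite size_segment.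
rewrite size_segment => m mlt; rewrite nth_mkseq // add0n.
have [k _ /(_ (i + k))] := cV m.
have [t ->] : exists t, rc_word c (i + k) 1 = rc_word c i 1 ++ t.
  elim: k => [|k [t IH]]; first by exists [::]; rewrite addn0 cats0.
  have [t' e] := rc_word1S (i + k); rewrite addnS e IH -catA.
  by eexists.
by case=> [|_ <-]; [exact: leq_addl|rewrite nth_cat mlt].
Qed.

Lemma construction_prefix_spacer V i : construction_of c V ->
  segment V 0 (size (rc_word c i 1) + first_spacer i) =
    rc_word c i 1 ++ nseq (first_spacer i) true.
Proof.
move=> /(construction_prefix i.+1); have [t ->] := rc_word1S i.
by rewrite catA => /segment_cat []; rewrite size_cat size_nseq.
Qed.

End Levels.

(** The concatenation criterion is applied with level [i.+1] made of the pieces over words of level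
    [2 * L + i], and with an artificial level 0 of pieces with core 0 below them. *)
Lemma finite_rank_of_block_code n (c : rank_construction n) (V : nat -> bool)
    (g : word -> bool) (R B L : nat) :
  let W m := g (segment V m R) in
  construction_of c V ->
  (forall p, exists2 i, i < B & V (p + i) = false) ->
  (forall p, exists2 i, i < L & W (p + i) = false) ->
  finite_symbolic_rank (X_of W).
Proof.
move=> W cV Vruns Wruns.
pose S i := level (rc_size c) (rc_word c) i.
have w1S i : rc_word c i 1 \in S i.
  by apply/mapP; exists 1 => //; rewrite mem_iota /=; have := rc_size_gt0 c i; lia.
(* Words of level [2 * L + i] are longer than [2 * L], so a piece contains two disjoint windows of
   length [L], hence two zeros. Its splitting at the zeros then has at least two factors. *)
pose Q i := block_over V W (S (2 * L + i)).
pose P i u := if i is i'.+1 then Q i' u else false \in u /\ core u = [:: false].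
pose e i := size (rc_word c i 1) + first_spacer c i.
have [p Wp Wlt] : exists2 p, W p = false & forall q, q < p -> W q.
  have exW : exists p, ~~ W p by have [q _ /negbT] := Wruns 0; exists q.
  exists (ex_minn exW); case: ex_minnP => p Wp pmin; first exact/negbTE.
  by move=> q qp; apply/negPn/negP => /pmin; lia.
pose d i := if i is i'.+1 then e (2 * L + i') else p.+1.
have d0E : segment W 0 (d 0) = nseq p true ++ [:: false].
  rewrite /d -addn1 segmentD; congr (_ ++ _); last by rewrite /segment /mkseq /= add0n addn0 Wp.
  apply: (@eq_from_nth _ false); rewrite size_segment ?size_nseq // => q qp.
  by rewrite nth_mkseq // nth_nseq qp Wlt.
have d0c : core (segment W 0 (d 0)) = [:: false].
  by rewrite d0E; apply: (core_pad p 0 (v := [:: false])).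
have Qz i u : Q i u -> 1 < count_mem false u.
  case=> [q [v [s [/level_size vs _ ->]]]].
  have z a : false \in segment W a L.
    have [k kL e0] := Wruns a; apply/mapP; exists k; by rewrite ?mem_iota.
  have -> : size v + s = L + (L + (size v + s - 2 * L)) by lia.
  rewrite !segmentD !count_cat.
  have := z q; have := z (q + L); rewrite -!has_pred1 !has_count; lia.
(* The successor leaves room for the one-word list of level 0. *)
apply: (@finite_rank_of_concatenations W P (n * B * 2 ^ R).+1 d).
- case=> [|i].
    by exists [:: [:: false]]; split => // u [_ ->]; rewrite mem_head.
  have [l [ls lP]] := finite_blocks_over g R (S (2 * L + i)) Vruns.
  exists (map core l); split; last by move=> u /lP /(map_f core).
  rewrite size_map ltnW // ltnS; apply: leq_trans ls _.
  rewrite !leq_mul2r size_map size_iota.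
  by case: (rc_gen c) => /(_ (2 * L + i)) /andP [_ ->]; rewrite !orbT.
- by move=> u [].
- case=> [u []//|i u /Qz]; rewrite -has_pred1 has_count; lia.
- case=> [|i]; first by split => //; rewrite d0E mem_cat mem_head orbT.
  exists 0, (rc_word c (2 * L + i) 1), (first_spacer c (2 * L + i)).
  by split => //; apply: construction_prefix_spacer.
- case=> [|i] u Pu.
    have u2 := Qz _ _ Pu.
    have [|us [us1 us2 us3]] := @split_zeros u; first by rewrite -has_pred1 has_count; lia.
    exists us; split => //; first by rewrite us1.
    rewrite d0c => _; case: us us1 us2 {us3} => [|w us] /=; first by move=> e0; rewrite -e0 in u2.
    by move=> _ /(_ w (mem_head _ _)) [].
  (* The same word may lie over several blocks. If it equals the distinguished prefix, the block at
     position 0 is selected, so that its first factor is the previous prefix. *)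
  have [q [j [s [jr sV uE uq]]]] : exists q j s,
     [/\ 1 <= j <= rc_size c (2 * L + i).+1,
       segment V q (size (rc_word c (2 * L + i).+1 j) + s) =
         rc_word c (2 * L + i).+1 j ++ nseq s true,
       u = segment W q (size (rc_word c (2 * L + i).+1 j) + s) &
       u = segment W 0 (d i.+2) -> q = 0 /\ j = 1].
    case: (eqVneq u (segment W 0 (d i.+2))) => [->|uN].
      exists 0, 1, (first_spacer c (2 * L + i).+1); split => //.
      + exact: rc_size_gt0.
      + exact: construction_prefix_spacer.
      + by rewrite /d /e addnS.
    move: Pu => [q [v [s [/level_memP [j jr ->] sV uE]]]].
    by rewrite addnS in jr sV uE; exists q, j, s; split => // /eqP; rewrite (negbTE uN).
  have [_ _ b0 bS bE] := rc_bldP jr.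
  rewrite -bE in sV uE.
  have [us [us1 us2 us3 us4]] := block_over_building W bS sV.
  exists us; split => //.
  + by rewrite us1 /bwords /= size_map; case: (brest _) b0.
  + by rewrite us3.
  + by move=> /uq [q0 j1]; rewrite us4 // q0 j1 rc_bld1.
Qed.

(** * Sliding block codes *)

Definition window (x : fullshift) (a : int) (l : nat) : word :=
  mkseq (fun i => x (a + i%:Z)%R) l.

Lemma eq_window (x y : fullshift) a l : window x a l = window y a l <->
  forall i, i < l -> x (a + i%:Z)%R = y (a + i%:Z)%R.
Proof.
split => [e i il|H].
  by have := congr1 (nth false ^~ i) e; rewrite !nth_mkseq.
by apply/eq_in_map => i; rewrite mem_iota => /H.
Qed.

Lemma near_window (T : Type) (F : set_system T) (u : T -> fullshift)
    (x : fullshift) (a : int) l :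
  Filter F -> (forall n, \forall m \near F, u m n = x n) ->
  \forall m \near F, window (u m) a l = window x a l.
Proof.
move=> FF H.
have : \forall m \near F, forall i, i < l -> u m (a + i%:Z)%R = x (a + i%:Z)%R.
  elim: l => [|l IH]; first exact: nearW.
  apply: filterS2 IH (H (a + l%:Z)%R) => m IH e i.
  by rewrite ltnS leq_eqVlt => /orP [/eqP ->|/IH].
by apply: filterS => m /eq_window.
Qed.

Lemma nbhs_window (x : fullshift) a l :
  nbhs x [set y | window y a l = window x a l].
Proof.
apply: (@near_window _ (nbhs x) id) => n.
have := @proj_continuous int (fun=> bool) n x [set x n].
by apply; apply: discrete_set1.
Qed.

Lemma cvg_fullshift (T : Type) (F : set_system T) (u : T -> fullshift)
    (x : fullshift) :
  Filter F -> (forall n, \forall m \near F, u m n = x n) -> u @ F --> x.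
Proof.
(* The product topology is the supremum of the initial topologies of the coordinate evaluations, so
   each coordinate is tested separately. *)
move=> FF H; apply/cvg_sup => i; apply/cvg_image.
  by apply/seteqP; split => // b _; exists (fun=> b).
move=> A /nbhs_singleton Ax /=.
exists [set y : fullshift | A (y i)].
  by apply: filterS (H i) => m /= ->.
by apply/seteqP; split => [b [y Ay <-] //|b Ab]; exists (fun=> b).
Qed.

(** An ultrafilter decides the value of every coordinate. This takes the place of compactness of the
    full shift and of diagonal subsequences. *)
Lemma ultra_limit (F : set_system nat) (u : nat -> fullshift) :
  UltraFilter F ->
  exists x : fullshift, forall n, \forall m \near F, u m n = x n.
Proof.
move=> FU; exists (fun n => `[< F [set m | u m n] >]) => n.
case: asboolP => [Fn|Fn]; first exact: Fn.
have [//|] := in_ultra_setVsetC [set m | u m n] FU.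
by apply: filterS => m /=; case: (u m n).
Qed.

Lemma free_ultrafilter : exists F : set_system nat,
  UltraFilter F /\ forall k, \forall m \near F, k <= m.
Proof.
have [F [FU le]] := @ultraFilterLemma nat \oo _.
by exists F; split => // k; apply: le; exists k.
Qed.

Lemma subshift_shift (X : set fullshift) x k :
  subshift X -> X x -> X (shift_by k x).
Proof.
move=> [_ XE] Xx.
have s1 y : X y -> X (shift_by 1 y) by move=> Xy; rewrite -XE; exists y.
have s2 y : X y -> X (shift_by (-1) y).
  rewrite -{1}XE => -[z Xz <-]; suff -> : shift_by (-1) (shift_map z) = z by [].
  by apply/funext => n; rewrite /shift_map /shift_by; congr (z _); lia.
elim: k => [|k|k] => [|IH|IH].
- suff -> : shift_by 0 x = x by [].
  by apply/funext => n; rewrite /shift_by; congr (x _); lia.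
- suff -> : shift_by (k.+1)%:Z x = shift_by 1 (shift_by k%:Z x) by apply: s1.
  by apply/funext => n; rewrite /shift_by; congr (x _); lia.
- suff -> : shift_by (- k.+1%:Z)%R x = shift_by (-1) (shift_by (- k%:Z)%R x) by apply: s2.
  by apply/funext => n; rewrite /shift_by; congr (x _); lia.
Qed.

Lemma equivariant_shift (X : set fullshift) (phi : fullshift -> fullshift) :
  subshift X -> (forall x, X x -> phi (shift_map x) = shift_map (phi x)) ->
  forall k x, X x -> phi (shift_by k x) = shift_by k (phi x).
Proof.
move=> sX eq; have s1 y : X y -> phi (shift_by 1 y) = shift_by 1 (phi y) by apply: eq.
have s2 y : X y -> phi (shift_by (-1) y) = shift_by (-1) (phi y).
  move=> Xy; have := s1 _ (subshift_shift (-1) sX Xy).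
  have -> : shift_by 1 (shift_by (-1) y) = y.
    by apply/funext => n; rewrite /shift_by; congr (y _); lia.
  by move=> ->; apply/funext => n; rewrite /shift_by; congr (phi _ _); lia.
have sD a b y : shift_by (a + b)%R y = shift_by a (shift_by b y).
  by apply/funext => n; rewrite /shift_by; congr (y _); lia.
elim=> [|k IH|k IH] x Xx.
- have s0 y : shift_by 0 y = y.
    by apply/funext => n; rewrite /shift_by; congr (y _); lia.
  by rewrite !s0.
- have -> : (k.+1%:Z = 1 + k%:Z)%R by lia.
  by rewrite !sD s1 ?IH //; apply: subshift_shift.
- have -> : (- k.+1%:Z = (-1) + - k%:Z)%R by lia.
  by rewrite !sD s2 ?IH //; apply: subshift_shift.
Qed.

(* Curtis-Hedlund-Lyndon; an ultrafilter turns a failing sequence of pairs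
   into a discontinuity. *)
Lemma sliding_block_code (X : set fullshift) (phi : fullshift -> fullshift) :
  subshift X -> {within X, continuous phi} ->
  (forall x, X x -> phi (shift_map x) = shift_map (phi x)) ->
  exists (M : nat) (g : word -> bool), forall x, X x -> forall n : int,
    phi x n = g (window x (n - M%:Z)%R (2 * M).+1).
Proof.
move=> sX phic eq.
have [M HM] : exists M : nat, forall x z, X x -> X z ->
    window x (- M%:Z)%R (2 * M).+1 = window z (- M%:Z)%R (2 * M).+1 ->
    phi x 0%R = phi z 0%R.
  apply: contrapT => H.
  have /choice [u uP] (M : nat) : exists p : fullshift * fullshift,
      [/\ X p.1, X p.2,
        window p.1 (- M%:Z)%R (2 * M).+1 = window p.2 (- M%:Z)%R (2 * M).+1 &
        phi p.1 0%R <> phi p.2 0%R].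
    apply: contrapT => H'; apply: H; exists M => x z Xx Xz e.
    by apply: contrapT => ne; apply: H'; exists (x, z).
  have [F [FU Foo]] := free_ultrafilter.
  have [x x1] := ultra_limit (fun m => (u m).1) FU.
  (* Both sequences have the same limit: once [m] is at least the absolute value of [n], coordinate
     [n] lies in the window on which the pair agrees. *)
  have x2 n : \forall m \near F, (u m).2 n = x n.
    near=> m; have -> : x n = (u m).1 n by apply/esym; near: m; apply: x1.
    have [_ _ /eq_window h _] := uP m.
    have nm : `|n|%N <= m by near: m; apply: Foo.
    have := h (absz (n + m%:Z)%R).
    have -> : (- m%:Z + (absz (n + m%:Z))%:Z = n)%R by lia.
    by move=> ->; lia.
  have X1 : \forall m \near F, X (u m).1 by apply: nearW => m; case: (uP m).
  have X2 : \forall m \near F, X (u m).2 by apply: nearW => m; case: (uP m).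
  have c1 : (fun m => (u m).1) @ F --> x by apply: cvg_fullshift.
  have c2 : (fun m => (u m).2) @ F --> x by apply: cvg_fullshift.
  have Xx : X x.
    case: sX => Xcl _; apply: (closed_cvg _ Xcl X1); exact: c1.
  have /subspace_continuousP /(_ x Xx) phix := phic.
  have near_phi (v : nat -> fullshift) : (\forall m \near F, X (v m)) ->
      v @ F --> x -> \forall m \near F, phi (v m) 0%R = phi x 0%R.
    move=> Xv vx.
    have /phix : nbhs (phi x) [set y | y 0%R = phi x 0%R].
      by have := nbhs_window (phi x) 0 1; apply: filterS => y /eq_window /(_ 0 isT); exact.
    move=> /vx; apply: filterS2 Xv => m /= Xm; exact.
  have [m [e1 e2]] : exists m, phi (u m).1 0%R = phi x 0%R /\ phi (u m).2 0%R = phi x 0%R.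
    have h1 := near_phi (fun m => (u m).1) X1 c1.
    have h2 := near_phi (fun m => (u m).2) X2 c2.
    exact: filter_ex (filterI h1 h2).
  by case: (uP m) => _ _ _; rewrite e1 e2.
(* By the choice of [M], all points of [X] with the same window give the same value; words that
   occur in no point of [X] at this window are sent to 0. *)
exists M, (fun w => `[< exists2 x, X x & window x (- M%:Z)%R (2 * M).+1 = w /\ phi x 0%R >]).
move=> x Xx n.
have -> : phi x n = phi (shift_by n x) 0%R.
  by rewrite (equivariant_shift sX eq) // /shift_by; congr (phi x _); lia.
have -> : window x (n - M%:Z)%R (2 * M).+1 = window (shift_by n x) (- M%:Z)%R (2 * M).+1.
  by apply: eq_map => i; rewrite /shift_by; congr (x _); lia.
have Xn := subshift_shift n sX Xx.
apply/idP/asboolP => [h|[z Xz [e h]]]; first by exists (shift_by n x).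
by rewrite (HM _ z).
Unshelve. all: by end_near. Qed.

Lemma window_segment (x : fullshift) (V : nat -> bool) a p l :
  window x a l = segment V p l <-> forall i, i < l -> x (a + i%:Z)%R = V (p + i).
Proof.
split => [e i il|H].
  by have := congr1 (nth false ^~ i) e; rewrite !nth_mkseq.
by apply/eq_in_map => i; rewrite mem_iota => /H.
Qed.

(** Reading to the right instead of symmetrically shifts the code by [M], which subwords do not see.
    Conversely, central windows of [y] occur in the coded word; a limit of the corresponding
    stretches of [V] is a preimage of [y]. *)
Lemma X_of_block_code (V : nat -> bool) (phi : fullshift -> fullshift)
    (g : word -> bool) (M : nat) :
  (forall x, X_of V x -> forall n : int,
     phi x n = g (window x (n - M%:Z)%R (2 * M).+1)) ->
  phi @` X_of V = X_of (fun m => g (segment V m (2 * M).+1)).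
Proof.
move=> phiE; set R := (2 * M).+1 in phiE *.
apply/seteqP; split => [_ [x Xx <-] u [a uE]|y Yy].
  set l := size u in uE.
  have [|p] := Xx (window x (a - M%:Z)%R (l + R)).
    by exists (a - M%:Z)%R; rewrite size_mkseq.
  rewrite size_mkseq -/(segment V p (l + R)) => /window_segment e.
  exists p; rewrite uE size_mkseq; apply/eq_in_map => i; rewrite mem_iota add0n => /= il.
  rewrite phiE //; congr g; apply/window_segment => j jR.
  have := e (i + j); rewrite addnA => <-; last by rewrite -addnS leq_add // ltnW.
  by congr (x _); lia.
have /choice [p pP] (m : nat) : exists p : nat,
    window y (- m%:Z)%R (2 * m).+1 =
    segment (fun m => g (segment V m R)) p (2 * m).+1.
  have [|p] := Yy (window y (- m%:Z)%R (2 * m).+1).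
    by exists (- m%:Z)%R; rewrite size_mkseq.
  by rewrite size_mkseq => e; exists p.
(* Coordinate [- m - M] carries the letter of [V] at [p m], so the code at coordinate [- m] reads
   from there. [absz] only makes the sequence total: the values further left are junk, avoided by
   taking [m] large. *)
pose u m : fullshift := fun n => V (p m + absz (n + m%:Z + M%:Z)%R).
have uV m a l : (0 <= a + m%:Z + M%:Z)%R ->
    window (u m) a l = segment V (p m + absz (a + m%:Z + M%:Z)%R) l.
  by move=> a0; apply/window_segment => i il; rewrite /u; congr (V _); lia.
have [F [FU Foo]] := free_ultrafilter.
have [x xu] := ultra_limit u FU.
have Xx : X_of V x.
  move=> w [a wE].
  have [m [e am]] : exists m, window (u m) a (size w) = window x a (size w) /\
      absz a <= m.
    exact: filter_ex (filterI (near_window a (size w) _ xu) (Foo (absz a))).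
  exists (p m + absz (a + m%:Z + M%:Z)%R).
  by rewrite -/(segment V _ _) -uV ?e //; lia.
exists x => //; apply/funext => n; rewrite phiE //.
have [m [<- nm]] : exists m, window (u m) (n - M%:Z)%R R = window x (n - M%:Z)%R R /\
    absz n <= m.
  exact: filter_ex (filterI (near_window _ _ _ xu) (Foo (absz n))).
rewrite uV; last by lia.
have := pP m => /window_segment /(_ (absz (n + m%:Z)%R)).
have -> : (- m%:Z + (absz (n + m%:Z))%:Z = n)%R by lia.
move=> ->; last by lia.
by congr (g (segment _ (_ + _) _)); lia.
Qed.

(** * Excluding the constant sequence of 1s *)

(** If [V] had arbitrarily long runs of 1s, every subword of the constant sequence would occur in
    it. *)
Lemma bounded_runs (V : nat -> bool) :
  ~ X_of V (fun=> true) ->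
  exists B : nat, forall p, exists2 i, i < B & V (p + i) = false.
Proof.
apply: contra_notP => H u [a uE].
have [p pP] : exists p, forall i, i < size u -> V (p + i).
  apply: contrapT => H'; apply: H; exists (size u) => p.
  apply: contrapT => H2; apply: H'; exists p => i iu.
  by apply: contrapT => /negP /negbTE e; apply: H2; exists i.
by exists p; rewrite {1}uE; apply/eq_in_map => i; rewrite mem_iota add0n => /= /pP ->.
Qed.

(** By density of the orbit of [x], every window of [z] occurs in [x], where the code gives 1. *)
Lemma minimal_code_constant (X : set fullshift) (phi : fullshift -> fullshift)
    (g : word -> bool) (M : nat) x :
  minimal_subshift X ->
  (forall x, X x -> forall n : int,
     phi x n = g (window x (n - M%:Z)%R (2 * M).+1)) ->
  X x -> phi x = (fun=> true) -> forall z, X z -> phi z = (fun=> true).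
Proof.
move=> [_ Xmin] phiE Xx phix z Xz; apply/funext => n.
have [_ [[k _ <-] /= e]] := Xmin _ Xx z Xz _ (nbhs_window z (n - M%:Z)%R (2 * M).+1).
rewrite phiE // -e.
suff -> : window (shift_by k x) (n - M%:Z)%R (2 * M).+1 =
    window x (n + k - M%:Z)%R (2 * M).+1 by rewrite -phiE // phix.
by apply: eq_map => i; rewrite /shift_by; congr (x _); lia.
Qed.

Theorem theorem8p3 (X Y : set fullshift) (hX : minimal_subshift X)
    (hXrank : finite_symbolic_rank X) (hY : subshift Y)
    (hYinf : infinite_set Y) (hYX : is_factor Y X) :
  finite_symbolic_rank Y.
Proof.
case: hXrank => n [_ [V [[c cV] XE]]].
case: hYX => phi [phic phiY phis].
have [M [g phiE]] := sliding_block_code hX.1 phic phis.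
have YE : Y = X_of (fun m => g (segment V m (2 * M).+1)).
  by rewrite -phiY XE; apply: X_of_block_code; rewrite -XE.
have YN : ~ Y (fun=> true).
  rewrite -{1}phiY => -[x Xx phix]; apply: hYinf.
  apply: (@sub_finite_set _ _ [set (fun=> true) : fullshift]) (finite_set1 _).
  by rewrite -phiY => _ [z Xz <-]; apply: (minimal_code_constant hX phiE Xx).
have XN : ~ X (fun=> true).
  move=> X1; apply: hYinf; rewrite -phiY; apply: finite_image.
  apply: (@sub_finite_set _ _ [set (fun=> true) : fullshift]) (finite_set1 _).
  (* The identity is the code with [M = 0] that reads the single letter of its window, so [X] would
     be one point and [Y] finite. *)
  move=> z Xz; apply: (@minimal_code_constant X id (head true) 0 _ hX _ X1) => //.
  by move=> x _ m /=; congr (x _); lia.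
rewrite XE in XN; rewrite YE in YN *.
have [B Vruns] := bounded_runs XN.
have [L Wruns] := bounded_runs YN.
exact: finite_rank_of_block_code cV Vruns Wruns.
Qed.
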